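(* Let $E = \mathbf{C}^n$, let $1 \leq j \leq n-1$ and let $W \leq E$ be a hyperplane (linear subspace of codimension one). Then $$\mathrm{diam}_+^{\mathrm{SL}_n(\mathbf{C})}\bigl(\Lambda^j E, \Lambda^j W\bigr) = j+1, \qquad \mathsf{R}\bigl(\Lambda^j E, \Lambda^j W\bigr) = \frac{j+1}{\lceil n/(n-j) \rceil}.$$
   Context: $\mathrm{SL}_n(\mathbf{C})$ acts on $\Lambda^j E$ through its natural action on $E$. For a group $H$ acting linearly on a finite-dimensional complex vector space $V$ and a nonzero subspace $U \leq V$, the group-additive diameter is $$\mathrm{diam}_+^{H}(V,U) = \min\{ m \mid g_1\cdot U + \dots + g_m\cdot U = V \text{ for some } g_1,\dots,g_m \in H\},$$ and, when $H$ acts irreducibly, the covering ratio is $\mathsf{R}(V,U) = \mathrm{diam}_+^{H}(V,U) / \lceil \dim V/\dim U\rceil$. *)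

(* Defs.v *)
From HB Require Import structures.
From mathcomp Require Import all_boot all_order all_algebra perm.
From mathcomp Require Import complex boolp reals.

Set Implicit Arguments.
Unset Strict Implicit.
Unset Printing Implicit Defensive.
Import Order.TTheory GRing.Theory Num.Theory.
Local Open Scope ring_scope.

Record lin_rep (F : fieldType) (H : groupType) (V : vectType F) := LinRep {
  rep_fun :> H -> 'End(V);
  rep_fun1 : rep_fun 1%g = \1%VF;
  rep_funM : forall g h, rep_fun (g * h)%g = (rep_fun g \o rep_fun h)%VF }.

Section Diameter.
Variables (F : fieldType) (H : groupType) (V : vectType F) (rho : lin_rep H V).
Implicit Types (U : {vspace V}) (m : nat).

Definition irreducible_rep : Prop :=
  {:V}%VS <> 0%VS /\
  forall U, (forall g, (rho g @: U <= U)%VS) -> U = 0%VS \/ U = {:V}%VS.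

Definition translates_span U m : Prop :=
  exists g : 'I_m -> H, (\sum_(i < m) (rho (g i) @: U))%VS = {:V}%VS.

(* The value is the junk 0 when no finite sum of translates fills V. *)
Definition diam U : nat :=
  if pselect (exists m, `[< translates_span U m >]) is left ex
  then ex_minn ex else 0%N.

Lemma diamP U m : translates_span U m ->
  (forall m', translates_span U m' -> (m <= m')%N) -> diam U = m.
Proof.
move=> Um minm; rewrite /diam; case: pselect => [ex|[]]; last first.
  by exists m; apply/asboolP.
case: ex_minnP => k /asboolP Uk mink; apply/eqP; rewrite eqn_leq minm // andbT.
by apply: mink; apply/asboolP.
Qed.

Lemma diam_gt0P U m : (0 < m)%N -> diam U = m ->
  translates_span U m /\ forall m', translates_span U m' -> (m <= m')%N.
Proof.
move=> m_gt0; rewrite /diam; case: pselect => [ex|_ m0]; last by rewrite -m0 in m_gt0.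
case: ex_minnP => k /asboolP Uk mink <-; split=> // m' Um'.
by apply: mink; apply/asboolP.
Qed.

(* Meaningful when rho is irreducible and U is nonzero; for exterior powers
   irreducibility is [ext_rep_irreducible]. *)
Definition covering_ratio U : rat :=
  (diam U)%:R / (Num.ceil ((\dim {:V})%:R / (\dim U)%:R : rat))%:~R.

End Diameter.

Section SpecialLinear.
Variables (F : fieldType) (n : nat).

Record SL := MkSL { SLval :> 'M[F]_n; _ : \det SLval == 1 }.
HB.instance Definition _ := [isSub for SLval].
HB.instance Definition _ := [Choice of SL by <:].

Lemma SLP (g : SL) : \det g = 1. Proof. by apply/eqP; case: g. Qed.

Lemma SL_unit (g : SL) : (g : 'M_n) \in unitmx.
Proof. by rewrite unitmxE SLP unitr1. Qed.

Fact SL_one_subproof : \det (1%:M : 'M[F]_n) == 1. Proof. by rewrite det1. Qed.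
Fact SL_mul_subproof (g h : SL) : \det (g *m h) == 1.
Proof. by rewrite det_mulmx !SLP mulr1. Qed.
Fact SL_inv_subproof (g : SL) : \det (invmx g) == 1.
Proof. by rewrite det_inv SLP invr1. Qed.

Definition SL_one := MkSL SL_one_subproof.
Definition SL_mul g h := MkSL (SL_mul_subproof g h).
Definition SL_inv g := MkSL (SL_inv_subproof g).

Fact SL_mulA : associative SL_mul.
Proof. by move=> g h k; apply: val_inj; rewrite /= mulmxA. Qed.
Fact SL_mul1g : left_id SL_one SL_mul.
Proof. by move=> g; apply: val_inj; rewrite /= mul1mx. Qed.
Fact SL_mulg1 : right_id SL_one SL_mul.
Proof. by move=> g; apply: val_inj; rewrite /= mulmx1. Qed.
Fact SL_mulVg : left_inverse SL_one SL_inv SL_mul.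
Proof. by move=> g; apply: val_inj; rewrite /= mulVmx ?SL_unit. Qed.
Fact SL_mulgV : right_inverse SL_one SL_inv SL_mul.
Proof. by move=> g; apply: val_inj; rewrite /= mulmxV ?SL_unit. Qed.

HB.instance Definition _ :=
  isGroup.Build SL SL_mulA SL_mul1g SL_mulg1 SL_mulVg SL_mulgV.

End SpecialLinear.

Section MultilinearMaps.
Variables (F : fieldType) (j : nat) (E M : lmodType F).
Implicit Types (v : 'I_j -> E) (f : ('I_j -> E) -> M).

Definition upd v (i : 'I_j) (x : E) : 'I_j -> E :=
  fun k => if k == i then x else v k.

Definition multilinear f : Prop :=
  forall v i a x y,
    f (upd v i (a *: x + y)) = a *: f (upd v i x) + f (upd v i y).

Definition alternating f : Prop :=
  forall v i k, i != k -> v i = v k -> f v = 0.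

Lemma upd_id v i : upd v i (v i) = v.
Proof. by apply/funext => k; rewrite /upd; case: eqP => [->|]. Qed.

Lemma upd_upd v i x y : upd (upd v i x) i y = upd v i y.
Proof. by apply/funext => k; rewrite /upd; case: eqP. Qed.

Lemma updC v i k x y : i != k -> upd (upd v i x) k y = upd (upd v k y) i x.
Proof.
move=> neq; apply/funext => l; rewrite /upd.
by case: eqP => [->|//]; rewrite eq_sym (negbTE neq).
Qed.

Lemma multilinearD f v i x y : multilinear f ->
  f (upd v i (x + y)) = f (upd v i x) + f (upd v i y).
Proof. by move=> fM; rewrite -{1}[x]scale1r fM scale1r. Qed.

Lemma multilinear0 f v i : multilinear f -> f (upd v i 0) = 0.
Proof.
move=> fM; apply: (addIr (f (upd v i 0))).
by rewrite -multilinearD // addr0 add0r.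
Qed.

Lemma alternating_tperm f v i k : multilinear f -> alternating f ->
  i != k -> f (v \o tperm i k) = - f v.
Proof.
move=> fM fA neq; pose w x y := upd (upd v i x) k y.
have wE x y : w x y i = x /\ w x y k = y.
  by rewrite /w /upd !eqxx (negbTE neq).
have wxx x : f (w x x) = 0.
  by case: (wE x x) => wi wk; apply: (fA _ i k) => //; rewrite wi wk.
have wD x y z : f (w x (y + z)) = f (w x y) + f (w x z) by exact: multilinearD.
have Dw x y z : f (w (x + y) z) = f (w x z) + f (w y z).
  by rewrite /w !(updC _ _ _ neq) multilinearD.
have := wxx (v i + v k); rewrite Dw !wD !wxx add0r addr0 => /eqP.
rewrite addrC addr_eq0 => /eqP.
have -> : w (v i) (v k) = v by rewrite /w upd_id upd_id.
move=> <-; congr f; apply/funext => l; rewrite /w /upd /=.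
case: tpermP => [->|->|/eqP li /eqP lk]; rewrite ?eqxx ?(negbTE neq) //.
by rewrite (negbTE lk) (negbTE li).
Qed.

Lemma alternating_perm f v (s : 'S_j) : multilinear f -> alternating f ->
  f (v \o s) = (-1) ^+ s *: f v.
Proof.
move=> fM fA; have [ts -> dts] := prod_tpermP s.
elim: ts dts => [_|t ts IHts /= /andP[dt /IHts {}IHts]].
  rewrite big_nil odd_perm1 expr0 scale1r; congr f.
  by apply/funext => i /=; rewrite perm1.
rewrite big_cons odd_permM odd_tperm dt signr_addb expr1 mulN1r scaleNr -IHts.
rewrite -(alternating_tperm _ fM fA dt); congr f.
by apply/funext => i /=; rewrite permM.
Qed.

End MultilinearMaps.

Lemma multilinear_expand (F : fieldType) (j : nat) (E M : lmodType F)
    (f : ('I_j -> E) -> M) (K : finType) (b : K -> E) (c : 'I_j -> K -> F) :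
  multilinear f ->
  f (fun i => \sum_k c i k *: b k) =
  \sum_(phi : {ffun 'I_j -> K}) (\prod_i c i (phi i)) *: f (b \o phi).
Proof.
elim: j f c => [|j IHj] f c fM.
  pose p : {ffun 'I_0 -> K} := ffun0 (card_ord 0).
  have allp (q : {ffun 'I_0 -> K}) : q = p by apply/ffunP; case.
  rewrite (bigD1 p) //= [X in _ + X]big1 => [|q]; last by rewrite (allp q) eqxx.
  by rewrite big_ord0 scale1r addr0; congr f; apply/funext; case.
pose cons (x : E) (v : 'I_j -> E) := oapp v x \o unlift ord0.
have consD v i x y : cons x (upd v i y) = upd (cons x v) (lift ord0 i) y.
  apply/funext => k; rewrite /cons /upd /=.
  case: unliftP => [l ->|->] /=; first by rewrite (inj_eq lift_inj).
  by [].
have cons0 v x y : cons y v = upd (cons x v) ord0 y.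
  apply/funext => k; rewrite /cons /upd /=.
  by case: unliftP => [l ->|->].
have fsum v I (r : seq I) (a : I -> F) (x : I -> E) :
    f (cons (\sum_(i <- r) a i *: x i) v) = \sum_(i <- r) a i *: f (cons (x i) v).
  elim: r => [|i r IHr].
    by rewrite !big_nil (cons0 _ 0) multilinear0.
  rewrite !big_cons (cons0 _ 0) fM -!cons0 IHr; by [].
have -> : (fun i => \sum_k c i k *: b k) =
    cons (\sum_k c ord0 k *: b k) (fun i => \sum_k c (lift ord0 i) k *: b k).
  by apply/funext => i; rewrite /cons /=; case: unliftP => [l ->|->].
rewrite fsum.
under eq_bigr => k _.
  rewrite (IHj (fun v => f (cons (b k) v))); last first.
    by move=> v i a x y; rewrite !consD fM.
  over.
under eq_bigr => k _ do rewrite scaler_sumr.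
rewrite pair_big /=.
pose h (p : K * {ffun 'I_j -> K}) : {ffun 'I_j.+1 -> K} :=
  [ffun i => oapp p.2 p.1 (unlift ord0 i)].
pose h' (q : {ffun 'I_j.+1 -> K}) : K * {ffun 'I_j -> K} :=
  (q ord0, [ffun i => q (lift ord0 i)]).
have hK : cancel h h'.
  case=> k p; rewrite /h' /h ffunE unlift_none /=; congr pair.
  by apply/ffunP => i; rewrite !ffunE liftK.
have h'K : cancel h' h.
  move=> q; apply/ffunP => i; rewrite /h ffunE.
  by case: unliftP => [l ->|->] //=; rewrite ffunE.
rewrite [RHS](reindex h) /=; last by exists h' => x _.
apply: eq_bigr => -[k p] _ /=; rewrite scalerA big_ord_recl /h ffunE unlift_none /=.
congr (_ * _ *: f _); first by apply: eq_bigr => i _; rewrite ffunE liftK.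
apply/funext => i; rewrite /cons /= ffunE.
by case: unliftP.
Qed.

Section ExteriorPower.
Variables (F : fieldType) (n : nat).
Implicit Types (j : nat).

Definition jset j := {S : {set 'I_n} | #|S| == j}.

Section Degree.
Variable j : nat.
Implicit Types (S T : jset j) (v w : 'I_j -> 'cV[F]_n).

(* The a-th element of S, in increasing order. *)
Definition elt S (a : 'I_j) : 'I_n :=
  enum_val (cast_ord (esym (eqP (valP S))) a).

(* The exterior power, written in the basis e_S = e_{s_1} /\ ... /\ e_{s_j}
   for S = {s_1 < ... < s_j}. *)
Definition extpow := {ffun jset j -> F^o}.
HB.instance Definition _ := Vector.on extpow.

(* The coordinates of v_1 /\ ... /\ v_j are the maximal minors of (v_1 ... v_j);
   [wedge_universal] shows that (extpow, wedge) is the exterior power. *)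
Definition wedge v : extpow :=
  [ffun S => \det (\matrix_(a < j, b < j) v a (elt S b) 0)].

Definition stdvec (i : 'I_n) : 'cV[F]_n := delta_mx i 0.

Definition ext_basis S : extpow := wedge (stdvec \o elt S).

Lemma elt_inj S : injective (elt S).
Proof. by move=> a b /enum_val_inj /cast_ord_inj. Qed.

Lemma elt_in S a : elt S a \in val S.
Proof. exact: enum_valP. Qed.

Lemma eltP S x : x \in val S -> exists a, x = elt S a.
Proof.
move=> xS; exists (cast_ord (eqP (valP S)) (enum_rank_in xS x)).
by rewrite /elt cast_ord_comp cast_ord_id enum_rankK_in.
Qed.

Lemma wedge_multilinear : multilinear wedge.
Proof.
move=> v i a x y; apply/ffunP => S; rewrite !ffunE.
rewrite -[X in _ = _ + X]mul1r.
apply: (@determinant_multilinear _ _ _ _ _ i).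
- by apply/rowP => b; rewrite !mxE /upd eqxx !mxE mul1r.
- by apply/matrixP => k l; rewrite !mxE /upd eq_sym (negbTE (neq_lift _ _)).
- by apply/matrixP => k l; rewrite !mxE /upd eq_sym (negbTE (neq_lift _ _)).
Qed.

Lemma wedge_alternating : alternating wedge.
Proof.
move=> v i k neq eqv; apply/ffunP => S; rewrite !ffunE.
by apply: (determinant_alternate neq) => b; rewrite !mxE eqv.
Qed.

Lemma ext_basisE S T : ext_basis S T = (S == T)%:R.
Proof.
rewrite ffunE; case: eqVneq => [<-|neq].
  have -> : (\matrix_(a, b) (stdvec \o elt S) a (elt S b) 0) = 1%:M.
    apply/matrixP => a b.
    by rewrite !mxE /= eqxx andbT (inj_eq (@elt_inj S)) eq_sym.
  by rewrite det1.
have [a aT] : exists a, elt S a \notin val T.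
  apply/existsP; rewrite -negb_forall; apply: contra neq => /forallP ST.
  apply/eqP/val_inj/eqP; rewrite eqEcard (eqP (valP S)) (eqP (valP T)) leqnn andbT.
  by apply/subsetP => x /eltP[b ->].
rewrite (expand_det_row _ a) big1 // => b _; rewrite !mxE /= eqxx andbT.
case: eqP => [eb|]; last by rewrite mul0r.
by rewrite -eb elt_in in aT.
Qed.

Lemma ext_basis_sum (x : extpow) : x = \sum_S x S *: ext_basis S.
Proof.
apply/ffunP => T; rewrite sum_ffunE (bigD1 T) //= big1 => [|S neq].
  by rewrite ffunE ext_basisE eqxx /= addr0 /GRing.scale /= mulr1.
by rewrite ffunE ext_basisE (negbTE neq) /GRing.scale /= mulr0.
Qed.

Lemma cV_stdvec_sum (x : 'cV[F]_n) : x = \sum_i x i 0 *: stdvec i.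
Proof.
apply/colP => k; rewrite summxE (bigD1 k) //= big1 => [|i neq].
  by rewrite !mxE !eqxx mulr1 addr0.
by rewrite !mxE eq_sym (negbTE neq) mulr0.
Qed.

(* An injective family of indices is a permutation of its image. *)
Lemma inj_elt (phi : 'I_j -> 'I_n) : injective phi ->
  exists S (s : 'S_j), phi = elt S \o s.
Proof.
move=> phi_inj.
have cS : #|[set phi a | a : 'I_j]| == j by rewrite card_imset // card_ord.
pose S : jset j := Sub [set phi a | a : 'I_j] cS.
have pS a : exists b, phi a == elt S b.
  by have [|b ->] := @eltP S (phi a); [apply: imset_f | exists b].
pose t a := xchoose (pS a).
have tE a : phi a = elt S (t a) by apply/eqP; exact: (xchooseP (pS a)).
have t_inj : injective t by move=> a b eqt; apply: phi_inj; rewrite !tE eqt.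
by exists S, (perm t_inj); apply/funext => a /=; rewrite permE.
Qed.

Lemma wedge_expand (M : lmodType F) (f : ('I_j -> 'cV[F]_n) -> M) v :
  multilinear f -> alternating f ->
  f v = \sum_S wedge v S *: f (stdvec \o elt S).
Proof.
move=> fM fA.
pose g w : M := \sum_S wedge w S *: f (stdvec \o elt S).
rewrite -/(g v).
have gM : multilinear g.
  move=> w i a x y; rewrite /g wedge_multilinear scaler_sumr -big_split /=.
  by apply: eq_bigr => S _; rewrite !ffunE scalerDl scalerA.
have gA : alternating g.
  move=> w i k neq eqw; rewrite /g (wedge_alternating neq eqw).
  by rewrite big1 // => S _; rewrite ffunE scale0r.
have -> : v = fun i => \sum_k v i k 0 *: stdvec k.
  by apply/funext => i; rewrite -cV_stdvec_sum.
rewrite (multilinear_expand _ _ fM) (multilinear_expand _ _ gM).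
apply: eq_bigr => phi _; congr (_ *: _).
have [/injectiveP phi_inj|/injectivePn[a [b neq eqphi]]] := boolP (injectiveb phi).
  have [S [s phiE]] := inj_elt phi_inj.
  have -> : stdvec \o phi = (stdvec \o elt S) \o s by rewrite phiE.
  rewrite !alternating_perm //; congr (_ *: _).
  rewrite /g (bigD1 S) //= big1 => [|T neq].
    by rewrite -/(ext_basis S) ext_basisE eqxx scale1r addr0.
  by rewrite -/(ext_basis S) ext_basisE eq_sym (negbTE neq) scale0r.
have eqv : (stdvec \o phi) a = (stdvec \o phi) b by rewrite /= eqphi.
by rewrite (fA _ _ _ neq eqv) (gA _ _ _ neq eqv).
Qed.

Theorem wedge_universal (M : lmodType F) (f : ('I_j -> 'cV[F]_n) -> M) :
  multilinear f -> alternating f ->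
  exists h : {linear extpow -> M},
    (forall v, h (wedge v) = f v) /\
    (forall h' : {linear extpow -> M}, (forall v, h' (wedge v) = f v) -> h' =1 h).
Proof.
move=> fM fA.
pose h (x : extpow) : M := \sum_S x S *: f (stdvec \o elt S).
have hL : linear h.
  move=> a x y; rewrite /h scaler_sumr -big_split /=.
  by apply: eq_bigr => S _; rewrite !ffunE scalerDl scalerA.
pose hl := GRing.isLinear.Build _ _ _ _ h hL.
pose H : {linear extpow -> M} := HB.pack h hl.
exists H; split=> [v|h' h'f x]; first by rewrite (wedge_expand v fM fA).
rewrite {1}[x]ext_basis_sum linear_sum /=.
by apply: eq_bigr => S _; rewrite linearZ /= h'f.
Qed.

(* The image of the j-th exterior power of W, i.e. the span of all
   w_1 /\ ... /\ w_j with w_i in W; see [ext_sub_wedge] and [ext_sub_min]. *)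
Definition ext_sub (W : {vspace 'cV[F]_n}) : {vspace extpow} :=
  <<[seq wedge (tnth (vbasis W) \o phi) | phi : {ffun 'I_j -> 'I_(\dim W)}]>>%VS.

Lemma ext_sub_wedge (W : {vspace 'cV[F]_n}) v :
  (forall i, v i \in W) -> wedge v \in ext_sub W.
Proof.
move=> vW.
have -> : v = fun i => \sum_k coord (vbasis W) k (v i) *: tnth (vbasis W) k.
  apply/funext => i; rewrite {1}(coord_vbasis (vW i)).
  by apply: eq_bigr => k _; rewrite (tnth_nth 0).
rewrite (multilinear_expand _ _ wedge_multilinear); apply: memv_suml => phi _.
by apply/memvZ/memv_span/map_f; rewrite mem_enum.
Qed.

Lemma ext_sub_min (W : {vspace 'cV[F]_n}) (U : {vspace extpow}) :
  (forall v, (forall i, v i \in W) -> wedge v \in U) -> (ext_sub W <= U)%VS.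
Proof.
move=> WU; apply/span_subvP => _ /mapP[phi _ ->].
by apply: WU => i; apply/vbasis_mem/mem_tnth.
Qed.

Lemma multilinear_mulmx (M : lmodType F) (f : ('I_j -> 'cV[F]_n) -> M)
    (g : 'M[F]_n) :
  multilinear f -> multilinear (fun v => f (fun i => g *m v i)).
Proof.
move=> fM v i a x y; have updE z :
    (fun k => g *m upd v i z k) = upd (fun k => g *m v k) i (g *m z).
  by apply/funext => k; rewrite /upd; case: eqP.
by rewrite !updE mulmxDr -scalemxAr fM.
Qed.

Lemma alternating_mulmx (M : lmodType F) (f : ('I_j -> 'cV[F]_n) -> M)
    (g : 'M[F]_n) :
  alternating f -> alternating (fun v => f (fun i => g *m v i)).
Proof. by move=> fA v i k neq eqv; apply: (fA _ i k); rewrite ?eqv. Qed.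

(* The j-th exterior power of x |-> g *m x; see [ext_map_wedge]. *)
Definition ext_map (g : 'M[F]_n) : 'End(extpow) :=
  linfun (fun x : extpow => \sum_S x S *: wedge (fun a => g *m stdvec (elt S a))).

Lemma ext_map_linear (g : 'M[F]_n) :
  linear (fun x : extpow => \sum_S x S *: wedge (fun a => g *m stdvec (elt S a))).
Proof.
move=> a x y; rewrite scaler_sumr -big_split /=.
by apply: eq_bigr => S _; rewrite !ffunE scalerDl scalerA.
Qed.

Lemma ext_mapE (g : 'M[F]_n) (x : extpow) :
  ext_map g x = \sum_S x S *: wedge (fun a => g *m stdvec (elt S a)).
Proof.
pose hl := GRing.isLinear.Build _ _ _ _ _ (ext_map_linear g).
pose H : {linear extpow -> extpow} := HB.pack (fun x : extpow => _) hl.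
exact: (lfunE H x).
Qed.

Lemma ext_map_wedge (g : 'M[F]_n) v :
  ext_map g (wedge v) = wedge (fun i => g *m v i).
Proof.
rewrite ext_mapE (wedge_expand v (multilinear_mulmx g wedge_multilinear)) //.
exact/alternating_mulmx/wedge_alternating.
Qed.

Lemma ext_map_eq (h k : 'End(extpow)) :
  (forall v, h (wedge v) = k (wedge v)) -> h = k.
Proof.
move=> hk; apply/lfunP => x; rewrite [x]ext_basis_sum !linear_sum /=.
by apply: eq_bigr => S _; rewrite !linearZ /= hk.
Qed.

Fact ext_rep_one : ext_map (1%g : SL F n) = \1%VF.
Proof.
apply: ext_map_eq => v; rewrite ext_map_wedge id_lfunE; congr wedge.
by apply/funext => i; rewrite /= mul1mx.
Qed.

Fact ext_rep_mul (g h : SL F n) :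
  ext_map (g * h)%g = (ext_map g \o ext_map h)%VF.
Proof.
apply: ext_map_eq => v; rewrite comp_lfunE !ext_map_wedge; congr wedge.
by apply/funext => i; rewrite mulmxA.
Qed.

Definition ext_rep : lin_rep (SL F n) extpow := LinRep ext_rep_one ext_rep_mul.

Lemma dim_extpow : \dim {:extpow} = 'C(n, j).
Proof.
rewrite dimvf -[X in 'C(X, _)]card_ord -card_draws cardsE.
by rewrite /dim /= muln1 card_sig.
Qed.

End Degree.
End ExteriorPower.

Section Irreducibility.
Variables (F : fieldType) (n j : nat).
Implicit Types (a b : 'I_n) (S T : jset n j) (x y : extpow F n j).

Lemma det_transvection a b : a != b -> \det (1%:M + delta_mx a b : 'M[F]_n) == 1.
Proof.
move=> neq; pose C : 'M[F]_n := \matrix_(i, k) (if i == a then b == k else i == k)%:R.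
have rC : row' a C = row' a (1%:M + delta_mx a b).
  apply/matrixP => i k.
  by rewrite !mxE eq_sym (negbTE (neq_lift _ _)) addr0.
have r1 : row' a (1%:M : 'M[F]_n) = row' a (1%:M + delta_mx a b).
  by apply/matrixP => i k; rewrite !mxE [lift a i == a]eq_sym (negbTE (neq_lift _ _)) addr0.
have ra : row a (1%:M + delta_mx a b : 'M[F]_n) = 1 *: row a 1%:M + 1 *: row a C.
  by apply/rowP => k; rewrite !mxE !mul1r eqxx (eq_sym k).
rewrite (determinant_multilinear ra r1 rC) det1 (@determinant_alternate _ _ C _ _ neq).
  by rewrite mulr0 addr0 mulr1.
by move=> k; rewrite !mxE eqxx [b == a]eq_sym (negbTE neq).
Qed.

Definition transvection a b (neq : a != b) : SL F n :=
  MkSL (det_transvection neq).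

Lemma transvection_stdvec a b k :
  (1%:M + delta_mx a b) *m stdvec F k = stdvec F k + (k == b)%:R *: stdvec F a.
Proof.
rewrite mulmxDl mul1mx /stdvec; congr (_ + _).
by rewrite mul_delta_mx_cond eq_sym scaler_nat.
Qed.

Definition exchange a b S : jset n j := insubd S (a |: val S :\ b).

Lemma val_exchange a b S : b \in val S -> a \notin val S ->
  val (exchange a b S) = a |: val S :\ b.
Proof.
move=> bS aS; rewrite insubdK // -topredE /= cardsU1 !inE (negbTE aS) andbF.
by have := valP S; rewrite /= (cardsD1 b) bS.
Qed.

Lemma exchange_inj a b S T :
    b \in val S -> a \notin val S -> b \in val T -> a \notin val T ->
  exchange a b S = exchange a b T -> S = T.
Proof.
move=> bS aS bT aT /(congr1 val); rewrite !val_exchange // => /setP e.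
apply/val_inj/setP => k; have := e k; rewrite !inE.
have [->|] := eqVneq k a; first by rewrite (negbTE aS) (negbTE aT).
by have [->|] := eqVneq k b; rewrite ?bS ?bT.
Qed.

Lemma transvection_basis a b (neq : a != b) S :
  if (b \in val S) && (a \notin val S) then
    exists2 c, c != 0 & ext_rep F n j (transvection neq) (ext_basis F S) - ext_basis F S
      = c *: ext_basis F (exchange a b S)
  else ext_rep F n j (transvection neq) (ext_basis F S) = ext_basis F S.
Proof.
rewrite /= {2 3}/ext_basis ext_map_wedge -/(ext_basis F S).
have wM := @wedge_multilinear F n j; have wA := @wedge_alternating F n j.
case: (boolP (b \in val S)) => [/eltP[i bE]|bS] /=; last first.
  congr wedge; apply/funext => i; rewrite transvection_stdvec.
  case: eqP => [eb|]; last by rewrite scale0r addr0.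
  by rewrite -eb elt_in in bS.
have -> : (fun k => (1%:M + delta_mx a b) *m (@stdvec F n \o elt S) k) =
    upd (@stdvec F n \o elt S) i (stdvec F b + stdvec F a).
  apply/funext => k; rewrite /upd transvection_stdvec bE (inj_eq (@elt_inj n j S)).
  by case: eqP => [->|]; rewrite ?scale1r ?scale0r ?addr0.
have uS : upd (@stdvec F n \o elt S) i (stdvec F b) = @stdvec F n \o elt S.
  by rewrite bE (upd_id (@stdvec F n \o elt S) i).
rewrite multilinearD // uS -!/(ext_basis F _).
case: ifPn => [aS|/negbNE/eltP[k aE]]; last first.
  have ik : i != k by apply: contra neq => /eqP ik; rewrite aE bE ik.
  have uE : upd (@stdvec F n \o elt S) i (stdvec F a) i =
      upd (@stdvec F n \o elt S) i (stdvec F a) k.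
    by rewrite /upd eqxx eq_sym (negbTE ik) /= -aE.
  by rewrite (wA _ i k ik uE) addr0.
rewrite addrC addKr.
pose phi k := if k == i then a else elt S k.
have -> : upd (@stdvec F n \o elt S) i (stdvec F a) = @stdvec F n \o phi.
  by apply/funext => k; rewrite /upd /phi /=; case: eqP.
have phi_inj : injective phi.
  move=> k l; rewrite /phi.
  have [->|_] := eqVneq k i; have [->|_] := eqVneq l i => //.
  - by move=> e; rewrite e elt_in in aS.
  - by move=> e; rewrite -e elt_in in aS.
  - exact: elt_inj.
have [T [s phiE]] := inj_elt phi_inj.
have phiT k : phi k \in val T by rewrite phiE /= elt_in.
exists ((-1) ^+ s); first by rewrite signr_eq0.
have -> : @stdvec F n \o phi = (@stdvec F n \o elt T) \o s by rewrite phiE.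
rewrite alternating_perm //; congr (_ *: ext_basis F _).
apply/esym/val_inj; rewrite val_exchange ?bE ?elt_in //.
apply/eqP; rewrite eqEcard; apply/andP; split.
  apply/subsetP => k; rewrite !inE => /orP[/eqP->|/andP[ki /eltP[l kE]]].
    by have := phiT i; rewrite /phi eqxx.
  have := phiT l; rewrite /phi -kE; case: eqP => // li.
  by rewrite kE li eqxx in ki.
by rewrite -val_exchange ?elt_in // (eqP (valP T)) (eqP (valP (exchange _ _ _))).
Qed.

Definition ext_supp x : {set jset n j} := [set S | x S != 0].

Lemma ext_rep_irreducible : (j <= n)%N -> irreducible_rep (ext_rep F n j).
Proof.
move=> jn; split=> [V0|U Ustab].
  have [S _] : exists S : jset n j, true.
    have : (0 < #|[set A : {set 'I_n} | #|A| == j]|)%N.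
      by rewrite card_draws card_ord bin_gt0.
    by case/card_gt0P => A; rewrite inE => cA; exists (Sub A cA).
  have : ext_basis F S \in {:extpow F n j}%VS by rewrite memvf.
  rewrite V0 memv0 => /eqP/ffunP/(_ S)/eqP.
  by rewrite ext_basisE eqxx ffunE oner_eq0.
have [->|Uneq0] := eqVneq U 0%VS; [by left|right].
have ex : exists m, `[< exists x, [/\ x \in U, x != 0 & #|ext_supp x| = m] >].
  exists #|ext_supp (vpick U)|; apply/asboolP; exists (vpick U).
  by rewrite memv_pick vpick0 Uneq0.
have [m /asboolP[x [xU x0 sx]] minx] := ex_minnP ex.
have stab g y : y \in U -> ext_rep F n j g y \in U.
  by move=> yU; apply: (subvP (Ustab g)); exact: memv_img.
have suppP y : y != 0 -> exists S, y S != 0.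
  move=> y0; apply/existsP; rewrite -negb_forall; apply: contra y0 => /forallP y0.
  by apply/eqP/ffunP => S; rewrite ffunE (eqP (y0 S)).
have exch S T : S != T -> exists a b,
    [/\ a != b, b \in val S, b \notin val T, a \in val T & a \notin val S].
  move=> neq.
  have sub (S1 S2 : jset n j) : S1 != S2 -> exists2 b, b \in val S1 & b \notin val S2.
    move=> neq12; apply/subsetPn; apply: contra neq12 => sub12.
    apply/eqP/val_inj/eqP; rewrite eqEcard sub12.
    by rewrite (eqP (valP S1)) (eqP (valP S2)) leqnn.
  have [b bS bT] := sub _ _ neq; rewrite eq_sym in neq.
  have [a aT aS] := sub _ _ neq; exists a, b; split=> //.
  by apply: contraNneq bT => <-.
have single S T : x S != 0 -> x T != 0 -> S = T.
  move=> xS xT; apply/eqP; apply: contraT => /exch[a [b [ab bS bT aT aS]]].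
  pose y := ext_rep F n j (transvection ab) x - x.
  have yU : y \in U by rewrite memvB ?stab.
  pose D := [set R : jset n j | (b \in val R) && (a \notin val R)].
  have yE : exists c : jset n j -> F, (forall R, c R != 0) /\
      y = \sum_(R in D) (x R * c R) *: ext_basis F (exchange a b R).
    have cE R : exists c, c != 0 /\ (R \in D ->
        ext_rep F n j (transvection ab) (ext_basis F R) - ext_basis F R
        = c *: ext_basis F (exchange a b R)).
      have := transvection_basis ab R; rewrite inE; case: ifP => _.
        by case=> c c0 cE; exists c.
      by exists 1; rewrite oner_neq0.
    have [c cP] := choice cE; exists c; split=> [R|]; first by case: (cP R).
    rewrite /y {1 2}[x]ext_basis_sum linear_sum -sumrB /= [RHS]big_mkcond /=.
    apply: eq_bigr => R _; rewrite linearZ -scalerBr.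
    case: ifP => RD; first by rewrite -scalerA; case: (cP R) => _ <-.
    have := transvection_basis ab R;
    move: RD; rewrite inE => ->.
    move=> e; rewrite [X in _ *: X](_ : _ = 0) ?scaler0 //.
    by apply/eqP; rewrite subr_eq0; apply/eqP.
  case: yE => c [c0 yE].
  have yS R : R \in D -> y (exchange a b R) = x R * c R.
    move=> RD; rewrite yE sum_ffunE (bigD1 R) //= [X in _ + X]big1 ?addr0.
      by rewrite ffunE ext_basisE eqxx /GRing.scale /= mulr1.
    move=> R' /andP[R'D neq]; rewrite ffunE ext_basisE.
    case: eqP => [e|_]; last by rewrite /GRing.scale /= mulr0.
    move: RD R'D; rewrite !inE => /andP[bR aR] /andP[bR' aR'].
    by rewrite (exchange_inj bR' aR' bR aR e) eqxx in neq.
  have SD : S \in D by rewrite inE bS aS.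
  have y0 : y != 0.
    apply/eqP => /ffunP/(_ (exchange a b S))/eqP.
    by rewrite yS // ffunE mulf_eq0 (negbTE xS) (negbTE (c0 S)).
  have : (m <= #|ext_supp y|)%N by apply: minx; apply/asboolP; exists y.
  suff: (#|ext_supp y| < #|ext_supp x|)%N by rewrite sx ltnNge => /negbTE ->.
  have suppy : ext_supp y \subset exchange a b @: (ext_supp x :\ T).
    apply/subsetP => R; rewrite inE; apply: contraR => RN.
    apply/eqP; rewrite yE sum_ffunE big1 // => R' R'D; rewrite ffunE ext_basisE.
    case: eqP => [e|_]; last by rewrite /GRing.scale /= mulr0.
    have [xR'|xR'] := eqVneq (x R') 0; first by rewrite xR' mul0r scale0r.
    case/negP: RN; apply/imsetP; exists R'; rewrite // !inE xR' andbT.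
    by apply: contraNneq bT => <-; move: R'D; rewrite inE => /andP[].
  apply: leq_ltn_trans (subset_leq_card suppy) _.
  apply: leq_ltn_trans (leq_imset_card _ _) _.
  by rewrite [X in (_ < X)%N](cardsD1 T) inE xT.
have [S xS] := suppP _ x0.
have SU : ext_basis F S \in U.
  have xE : x = x S *: ext_basis F S.
    rewrite {1}[x]ext_basis_sum (bigD1 S) //= big1 ?addr0 // => T neq.
    have [->|xT] := eqVneq (x T) 0; first by rewrite scale0r.
    by rewrite (single _ _ xT xS) eqxx in neq.
  by rewrite -[ext_basis F S](scalerK xS) -xE memvZ.
have allU T : ext_basis F T \in U.
  have [k] := ubnP #|val T :\: val S|; elim: k T => // k IHk T.
  have [->//|/exch[b [a [ba aT aS bS bT]]]] := eqVneq T S.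
  pose R := exchange b a T.
  have Rval : val R = b |: val T :\ a by rewrite /R val_exchange.
  have ab : a != b by rewrite eq_sym.
  have TE : exchange a b R = T.
    apply: val_inj; rewrite val_exchange Rval ?setU11 ?inE ?eqxx ?(negbTE ab) //.
    apply/setP => l; rewrite !inE; have [->|la] := eqVneq l a; first by rewrite aT.
    by have [->|lb] := eqVneq l b; rewrite ?(negbTE bT) //=.
  rewrite ltnS => lek; have RU : ext_basis F R \in U.
    apply: IHk; apply: leq_trans lek; apply: proper_card; apply/properP; split.
      apply/subsetP => l; rewrite Rval !inE => /andP[lS /orP[/eqP lb|/andP[_ lT]]].
        by rewrite lb bS in lS.
      by rewrite lS.
    by exists a; rewrite ?Rval !inE ?aS ?aT // eqxx (negbTE ab).
  have := transvection_basis ab R; rewrite Rval !inE !eqxx (negbTE ab) /=.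
  case=> c c0; rewrite TE => e.
  rewrite -[ext_basis F T](scalerK c0) -e memvZ // memvB //.
  exact: (stab (transvection ab)).
apply/eqP; rewrite eqEsubv subvf /=; apply/subvP => y _.
by rewrite [y]ext_basis_sum memv_suml // => T _; rewrite memvZ.
Qed.

End Irreducibility.

(* Main.v *)
Require Import Defs.
From mathcomp Require Import all_boot all_order all_algebra.
From mathcomp Require Import complex boolp reals.
Import GRing.Theory Num.Theory.
Local Open Scope ring_scope.
Local Open Scope complex_scope.

Set Implicit Arguments.
Unset Strict Implicit.
Unset Printing Implicit Defensive.

(** Everything works over an arbitrary field F, in the basis e_S of the exterior
power. Write the hyperplane W as the kernel of a nonzero row phi
([hyperplane_kernel]); then gW is the kernel of phi g^-1, so translates of the
j-th exterior power of W are exterior powers of hyperplanes.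

Upper bound. Any nonzero row is, up to a scalar, a prescribed row of some matrix
of determinant 1 ([SL_row]), so SL_n moves W onto each coordinate hyperplane
x_i = 0. The translate of the exterior power is then the span of the e_S with i
outside S ([ext_rep_hyperplane]). Taking the indices i = 0, ..., j gives j + 1
translates whose sum contains every e_S, because a set S of j elements misses one
of j + 1 indices ([hyperplane_translates_span]).

Lower bound. Let phi_1, ..., phi_m with m <= j be the rows defining m translates
of W. Choose j independent rows, forming a matrix A, whose span contains all the
phi_i ([row_free_above]). The functional sending v_1 /\ ... /\ v_j to the
determinant of the vectors A v_1, ..., A v_j is nonzero on the exterior power
([rows_det_neq0]), but it kills the exterior power of each kernel of phi_i: there
the vectors A v_b lie in a common hyperplane of F^j ([rows_det_vanishes]). Hence
m translates do not suffice ([hyperplane_translates_span_ge]).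

Covering ratio. The description of a single translate also gives the dimension
'C(n - 1, j) of the exterior power of W ([dim_ext_sub_hyperplane]), and
'C(n, j) / 'C(n - 1, j) = n / (n - j). *)

(** * Hyperplanes and the action of the special linear group *)

Section Hyperplanes.
Variables (F : fieldType) (n : nat).
Implicit Types (W : {vspace 'cV[F]_n}) (phi : 'rV[F]_n).

Lemma hyperplane_kernel W : (0 < n)%N -> \dim W = (n - 1)%N ->
  exists2 phi : 'rV_n, phi != 0 & forall x : 'cV_n, (x \in W) = (phi *m x == 0).
Proof.
move=> n_gt0 dimW.
pose M : 'M[F]_(n, \dim W) := \matrix_(k, a) tnth (vbasis W) a k 0.
(* The matrix M has at most n - 1 columns, so its n rows are dependent. *)
have : kermx M != 0.
  rewrite kermx_eq0 -row_leq_rank -ltnNge.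
  by rewrite (leq_ltn_trans (rank_leq_col M)) // dimW subn1 prednK.
case/rowV0Pn => phi /sub_kermxP phiM phi0; exists phi => //.
pose f : {linear 'cV[F]_n -> 'cV[F]_1} := mulmx phi.
have kerE x : (x \in lker (linfun f)) = (phi *m x == 0).
  by rewrite memv_ker lfunE.
suff -> : W = lker (linfun f) by [].
apply/eqP; rewrite eqEdim; apply/andP; split.
  apply/subvP => x xW; rewrite kerE (coord_vbasis xW) mulmx_sumr big1 // => a _.
  rewrite -scalemxAr [X in _ *: X](_ : _ = 0) ?scaler0 //.
  have -> : (vbasis W)`_a = col a M by apply/colP => k; rewrite !mxE (tnth_nth 0).
  by rewrite colE mulmxA phiM mul0mx.
(* The row phi is nonzero, so its image has positive dimension, and rank-nullity
   bounds the dimension of its kernel by n - 1. *)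
have img_gt0 : (0 < \dim (linfun f @: {:'cV[F]_n}))%N.
  rewrite lt0n dimv_eq0; apply: contra phi0 => /eqP img0.
  apply/eqP/rowP => k; rewrite mxE.
  have : linfun f (delta_mx k 0) \in (linfun f @: {:'cV[F]_n})%VS.
    by rewrite memv_img ?memvf.
  by rewrite img0 memv0 lfunE /= -colE => /eqP/matrixP/(_ 0 0); rewrite !mxE.
have := limg_ker_dim (linfun f) {:'cV[F]_n}.
rewrite capfv dimvf /dim /= muln1 dimW leq_subRL // => e.
by rewrite -[X in (_ <= X)%N]e addnC leq_add2l.
Qed.

(** Transitivity of SL_n on hyperplanes, in dual form: complete phi to an
invertible matrix with phi as i-th row, then rescale that row alone to bring the
determinant to 1. *)
Lemma SL_row phi (i : 'I_n) : phi != 0 ->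
  exists (g : SL F n) (c : F), c != 0 /\ row i g = c *: phi.
Proof.
move=> phi0.
have rk m (v : 'rV[F]_m) : v != 0 -> \rank v = 1%N by rewrite rank_rV => ->.
have d0 : delta_mx 0 i != 0 :> 'rV[F]_n.
  by apply/eqP => /rowP/(_ i)/eqP; rewrite !mxE !eqxx oner_eq0.
have dE : delta_mx 0 i *m (\matrix_k phi) = phi :> 'rV[F]_n.
  by rewrite -rowE rowK.
(* The map with all rows phi sends the row delta_mx 0 i to phi, and some
   invertible map agrees with it on that row, since phi has rank 1. *)
have [|G uG] := @complete_unitmx F 1 n (delta_mx 0 i) (\matrix_(k < n) phi).
  by rewrite dE !rk.
rewrite dE -rowE => phiE.
have d_neq0 : \det G != 0 by rewrite -unitfE -unitmxE.
pose c := (\det G)^-1.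
pose g : 'M[F]_n := \matrix_(k, l) (if k == i then c * G k l else G k l).
have det_g : \det g == 1.
  have r' : row' i G = row' i g.
    by apply/matrixP => k l; rewrite !mxE eq_sym (negbTE (neq_lift _ _)).
  have r : row i g = c *: row i G + 0 *: row i G.
    by rewrite scale0r addr0; apply/rowP => l; rewrite !mxE eqxx.
  by rewrite (determinant_multilinear r r' r') mul0r addr0 mulVf.
exists (MkSL det_g), c; split; first by rewrite invr_eq0.
by rewrite phiE; apply/rowP => l; rewrite !mxE eqxx.
Qed.

End Hyperplanes.

(** * Translates of the exterior power of a hyperplane *)

Section Translates.
Variables (F : fieldType) (n j : nat).
Implicit Types (W : {vspace 'cV[F]_n}) (U : {vspace extpow F n j}).
Implicit Types (phi : 'rV[F]_n) (S T : jset n j) (i : 'I_n) (g : SL F n).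

Lemma ext_rep_img_sub g W U :
  (forall w, (forall a, w a \in W) -> wedge (fun a => g *m w a) \in U) ->
  (ext_rep F n j g @: ext_sub j W <= U)%VS.
Proof.
move=> gWU.
have sub : (ext_sub j W <= ext_rep F n j g @^-1: U)%VS.
  by apply: ext_sub_min => w wW; rewrite -memv_preim ext_map_wedge gWU.
by apply/subvP => _ /memv_imgP[x /(subvP sub) xU ->]; rewrite memv_preim.
Qed.

(** The exterior power of the coordinate hyperplane x_i = 0. *)
Definition coord_span i : {vspace extpow F n j} :=
  <<image (@ext_basis F n j) [pred S : jset n j | i \notin val S]>>%VS.

Lemma mem_coord_span i S : i \notin val S -> ext_basis F S \in coord_span i.
Proof. by move=> iS; apply/memv_span/image_f. Qed.

Lemma ext_basis_free : free (codom (@ext_basis F n j)).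
Proof.
apply: (basis_free (U := fullv)); rewrite basisEdim; apply/andP; split.
  apply/subvP => x _; rewrite [x]ext_basis_sum memv_suml // => S _.
  by rewrite memvZ // memv_span // codom_f.
rewrite size_codom dim_extpow -[X in 'C(X, _)]card_ord -card_draws.
by rewrite cardsE card_sig.
Qed.

Lemma dim_coord_span i : \dim (coord_span i) = 'C(n.-1, j).
Proof.
(* [filter_free] selects vectors by a predicate on the vectors themselves; p reads
   off from the vector e_S whether i belongs to S. *)
pose p (x : extpow F n j) := [forall S, (x S != 0) ==> (i \notin val S)].
have pE S : p (ext_basis F S) = (i \notin val S).
  apply/forallP/idP => [/(_ S)|iS T].
    by rewrite ext_basisE eqxx oner_eq0.
  by rewrite ext_basisE; case: (eqVneq S T) => [<-|_]; rewrite ?iS ?implybT ?eqxx.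
have /eqP : free (image (@ext_basis F n j) [pred S : jset n j | i \notin val S]).
  rewrite /image_mem /enum_mem -enumT.
  rewrite -(eq_filter (a1 := preim (@ext_basis F n j) p)) => [|S]; last exact: pE.
  by rewrite -filter_map filter_free ?ext_basis_free.
rewrite -/(coord_span i) size_map -cardE => ->.
have -> : n.-1 = #|[set~ i]| by rewrite cardsC1 card_ord.
rewrite -cards_draws -(card_imset _ val_inj).
apply: eq_card => A; rewrite inE -disjoints_subset disjoint_sym disjoints1.
apply/imsetP/andP => [[S iS ->]|[iA cA]]; first by split; last exact: (valP S).
by exists (Sub A cA).
Qed.

(** The row condition says that g maps W onto the hyperplane x_i = 0. A wedge of
vectors with zero i-th coordinate has no component on e_S when S contains i, as
its maximal minor on S has a zero column; conversely e_S with i outside S is a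
wedge of vectors g w with w in W, namely w = g^-1 e_s. *)
Lemma ext_rep_hyperplane g i phi (c : F) W : c != 0 ->
  row i g = c *: phi -> (forall x : 'cV_n, (x \in W) = (phi *m x == 0)) ->
  (ext_rep F n j g @: ext_sub j W)%VS = coord_span i.
Proof.
move=> c0 rE WE.
have gWE x : ((g *m x) i 0 == 0) = (x \in W).
  have -> : (g *m x) i 0 = c * (phi *m x) 0 0.
    transitivity ((row i g *m x) 0 0); first by rewrite -row_mul [RHS]mxE.
    by rewrite rE -scalemxAl mxE.
  rewrite mulf_eq0 (negbTE c0) WE; apply/eqP/eqP => [e|->]; last by rewrite mxE.
  by apply/matrixP => a b; rewrite !ord1 e mxE.
apply/eqP; rewrite eqEsubv; apply/andP; split.
  apply: ext_rep_img_sub => w wW.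
  rewrite [wedge _]ext_basis_sum memv_suml // => S _.
  have [iS|iS] := boolP (i \in val S); last by rewrite memvZ ?mem_coord_span.
  have [b ib] := eltP iS.
  rewrite ffunE (expand_det_col _ b) big1 ?scale0r ?mem0v // => a _.
  have /eqP wi : (g *m w a) i 0 == 0 by rewrite gWE.
  by rewrite mxE -ib wi mul0r.
apply/span_subvP => _ /imageP[S + ->]; rewrite inE => iS.
have -> : ext_basis F S = ext_rep F n j g
    (wedge (fun a => invmx g *m stdvec F (elt S a))).
  rewrite ext_map_wedge; congr wedge; apply/funext => a /=.
  by rewrite mulKVmx ?SL_unit.
apply/memv_img/ext_sub_wedge => a.
rewrite -gWE mulKVmx ?SL_unit // mxE andbT.
by case: (eqVneq i (elt S a)) => // ia; rewrite ia elt_in in iS.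
Qed.

Lemma ext_rep_inj g : lker (ext_rep F n j g) = 0%VS.
Proof.
apply/eqP/lker0P => x y e.
have gK z : ext_rep F n j g^-1%g (ext_rep F n j g z) = z.
  by rewrite -comp_lfunE -rep_funM mulVg rep_fun1 id_lfunE.
by rewrite -[x]gK e gK.
Qed.

Lemma dim_ext_sub_hyperplane W phi : phi != 0 ->
  (forall x : 'cV_n, (x \in W) = (phi *m x == 0)) ->
  \dim (ext_sub j W) = 'C(n.-1, j).
Proof.
move=> phi0 WE.
have [k _] : exists k, phi 0 k != 0.
  apply/existsP; rewrite -negb_forall; apply: contra phi0 => /forallP e.
  by apply/eqP/rowP => k; rewrite mxE (eqP (e k)).
have [g [c [c0 rE]]] := SL_row k phi0.
rewrite -(dim_coord_span k) -(ext_rep_hyperplane c0 rE WE) limg_dim_eq //.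
by rewrite ext_rep_inj capv0.
Qed.

(** Upper bound: move W onto the hyperplanes x_i = 0 for i = 0, ..., j; a set of
j indices cannot contain all of 0, ..., j. *)
Lemma hyperplane_translates_span W phi : (j < n)%N -> phi != 0 ->
  (forall x : 'cV_n, (x \in W) = (phi *m x == 0)) ->
  translates_span (ext_rep F n j) (ext_sub j W) j.+1.
Proof.
move=> jn phi0 WE.
have /choice[g gE] (a : 'I_j.+1) : exists g,
    (ext_rep F n j g @: ext_sub j W)%VS = coord_span (widen_ord jn a).
  have [g [c [c0 rE]]] := SL_row (widen_ord jn a) phi0.
  by exists g; apply: ext_rep_hyperplane c0 rE WE.
exists g; apply/eqP; rewrite eqEsubv subvf /=; apply/subvP => x _.
rewrite [x]ext_basis_sum memv_suml // => S _; rewrite memvZ //.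
have [a aS] : exists a : 'I_j.+1, widen_ord jn a \notin val S.
  apply/existsP; rewrite -negb_forall; apply/negP => /forallP sub.
  have : (#|[set widen_ord jn a | a : 'I_j.+1]| <= #|val S|)%N.
    by apply/subset_leq_card/subsetP => _ /imsetP[a _ ->].
  rewrite card_imset ?card_ord ?(eqP (valP S)) ?ltnn // => a b e.
  by apply/val_inj; have := congr1 val e.
apply: (subvP (sumv_sup a _ (subvv _))) => //.
by rewrite gE mem_coord_span.
Qed.

(** * The separating functional *)

(** By [wedge_universal] this is a linear form on the exterior power: the wedge
product of the j linear forms given by the rows of A. *)
Definition rows_det (A : 'M[F]_(j, n)) (v : 'I_j -> 'cV[F]_n) : F^o :=
  \det (\matrix_(a, b) (A *m v a) b 0).

Lemma rows_det_multilinear A : multilinear (rows_det A).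
Proof.
move=> v i a x y; rewrite -[X in _ = _ + X]mul1r.
apply: (@determinant_multilinear _ _ _ _ _ i).
- apply/rowP => b; rewrite !mxE /upd eqxx mul1r mulr_sumr -big_split /=.
  by apply: eq_bigr => k _; rewrite !mxE mulrDr mulrCA.
- by apply/matrixP => k l; rewrite !mxE /upd eq_sym (negbTE (neq_lift _ _)).
- by apply/matrixP => k l; rewrite !mxE /upd eq_sym (negbTE (neq_lift _ _)).
Qed.

Lemma rows_det_alternating A : alternating (rows_det A).
Proof.
move=> v i k neq eqv.
by apply: (determinant_alternate neq) => b; rewrite !mxE eqv.
Qed.

(** If psi = d A with d nonzero, all the vectors A v_a lie in the kernel of d,
a hyperplane of F^j, so they are dependent. *)
Lemma rows_det_vanishes (A : 'M_(j, n)) (psi : 'rV_n) v :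
  psi != 0 -> (psi <= A)%MS -> (forall a, psi *m v a = 0) -> rows_det A v = 0.
Proof.
move=> psi0 /submxP[d psiE] psiv.
rewrite /rows_det; set N := (X in \det X).
apply/eqP; apply: contraT => detN.
have uN : N^T \in unitmx by rewrite unitmx_tr unitmxE unitfE.
have dN : d *m N^T = 0.
  apply/rowP => a; rewrite [RHS]mxE.
  have := psiv a; rewrite psiE -mulmxA => /matrixP/(_ 0 0).
  by rewrite !mxE => e; rewrite -[RHS]e; apply: eq_bigr => b _; rewrite !mxE.
case/negP: psi0; rewrite psiE.
by rewrite -[d](mulmxK uN) dN !mul0mx.
Qed.

(** The columns of a right inverse of A are sent by A to the standard basis. *)
Lemma rows_det_neq0 (A : 'M_(j, n)) : row_free A -> exists v, rows_det A v != 0.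
Proof.
case/row_freeP => B AB; exists (fun a => col a B).
rewrite /rows_det (_ : \matrix_(a, b) _ = 1%:M) ?det1 ?oner_neq0 //.
apply/matrixP => a b; rewrite mxE.
have -> : A *m col a B = col a 1%:M by rewrite !colE mulmxA AB.
by rewrite !mxE eq_sym.
Qed.

(** Gaussian elimination writes P as a combination of the first \rank P rows of an
invertible matrix; as \rank P <= j, its first j rows do. *)
Lemma row_free_above m (P : 'M[F]_(m, n)) : (m <= j)%N -> (j <= n)%N ->
  exists2 A : 'M[F]_(j, n), row_free A & (P <= A)%MS.
Proof.
move=> mj jn; exists (pid_mx j *m row_ebase P).
  rewrite /row_free mxrankMfree ?rank_pid_mx //.
  by rewrite row_free_unit row_ebase_unit.
have rj : (\rank P <= j)%N := leq_trans (rank_leq_row P) mj.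
apply/submxP; exists (col_ebase P *m pid_mx (\rank P)).
rewrite -mulmxA (mulmxA (pid_mx _) (pid_mx _)) mul_pid_mx.
have -> : minn j (minn (\rank P) j) = \rank P.
  by rewrite (minn_idPl rj) (minn_idPr rj).
by rewrite mulmxA mulmx_ebase.
Qed.

(** Lower bound: the i-th translate of W is the kernel of phi g_i^-1. Independent
rows spanning all these m <= j forms define a nonzero functional vanishing on
every translate of the exterior power. *)
Lemma hyperplane_translates_span_ge W phi m : (j <= n)%N -> phi != 0 ->
  (forall x : 'cV_n, (x \in W) = (phi *m x == 0)) ->
  translates_span (ext_rep F n j) (ext_sub j W) m -> (j < m)%N.
Proof.
move=> jn phi0 WE [g spanV]; rewrite ltnNge; apply/negP => mj.
pose P : 'M[F]_(m, n) := \matrix_a (phi *m invmx (g a)).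
have [A freeA PA] := row_free_above P mj jn.
have [h [hE _]] := wedge_universal (@rows_det_multilinear A) (@rows_det_alternating A).
have [v] := rows_det_neq0 freeA; rewrite -hE.
have : wedge v \in (\sum_(i < m) ext_rep F n j (g i) @: ext_sub j W)%VS.
  by rewrite spanV memvf.
suff : (\sum_(i < m) ext_rep F n j (g i) @: ext_sub j W <= lker (linfun h))%VS.
  by move=> /subvP sub /sub; rewrite memv_ker lfunE /= => /eqP ->; rewrite eqxx.
apply/subv_sumP => i _; apply: ext_rep_img_sub => w wW.
rewrite memv_ker lfunE /= hE (@rows_det_vanishes _ (phi *m invmx (g i))) //.
- apply: contra phi0 => /eqP e.
  by rewrite -[phi](mulmxKV (SL_unit (g i))) e mul0mx.
- apply: submx_trans PA.
  by rewrite -[X in (X <= _)%MS](rowK (fun a => phi *m invmx (g a))) row_sub.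
- by move=> a; rewrite mulmxA mulmxKV ?SL_unit //; apply/eqP; rewrite -WE.
Qed.

End Translates.

(** * The diameter and the covering ratio *)

Unset Implicit Arguments.

Theorem proposition5p9 (R : realType) (n j : nat) (W : {vspace 'cV[R[i]]_n}) :
  (1 <= j <= n - 1)%N ->
  \dim W = (n - 1)%N ->
  diam (ext_rep R[i] n j) (ext_sub j W) = j.+1 /\
  covering_ratio (ext_rep R[i] n j) (ext_sub j W) =
    (j.+1)%:R / (Num.ceil (n%:R / (n - j)%:R : rat))%:~R.
Proof.
move=> /andP[j_gt0 jn1] dimW.
have n_gt0 : (0 < n)%N by case: n jn1 {W dimW} => //; rewrite leqNgt j_gt0.
have jn : (j < n)%N by rewrite -(subnK n_gt0) addn1 ltnS.
have [phi phi0 WE] := hyperplane_kernel n_gt0 dimW.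
have diamE : diam (ext_rep R[i] n j) (ext_sub j W) = j.+1.
  apply: diamP; first exact: hyperplane_translates_span jn phi0 WE.
  by move=> m; apply: hyperplane_translates_span_ge (ltnW jn) phi0 WE.
split=> //; rewrite /covering_ratio diamE dim_extpow.
rewrite (dim_ext_sub_hyperplane _ phi0 WE).
suff -> : 'C(n, j)%:R / 'C(n.-1, j)%:R = n%:R / (n - j)%:R :> rat by [].
have bin0 : 'C(n.-1, j)%:R != 0 :> rat.
  by rewrite pnatr_eq0 -lt0n bin_gt0 -ltnS prednK.
have sub0 : (n - j)%:R != 0 :> rat by rewrite pnatr_eq0 subn_eq0 -ltnNge.
apply/eqP; rewrite eqr_div // -!natrM eqr_nat; apply/eqP.
by rewrite mul_bin_down mulnC.
Qed.
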